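(* Let $l\ge1$ be an integer and let $\{m_k\}_{k\ge1}$ be an enumeration (not necessarily increasing) of the integers in $\mathcal D^*(l)$. Let $c_k$, $k\ge1$, be complex numbers. Then the series $$\sum_{k}c_ke^{im_kx}$$ converges for almost every $x$ if and only if $\sum_k|c_k|^2<\infty$.
   Context: For an integer $s\ge1$, $\mathcal D(s)$ is the set of integers of the form $2^{k_1}+2^{k_2}+\dots+2^{k_s}$ with integers $k_1>k_2>\dots>k_s\ge1$, and $\mathcal D^*(l)=\bigcup_{1\le s\le l}\mathcal D(s)$. An enumeration lists every element exactly once, in an arbitrary order. *)

(* Defs.v *)
From HB Require Import structures.
From mathcomp Require Export all_boot all_order all_algebra.
From mathcomp Require Export complex.
From mathcomp Require Export all_classical all_reals all_analysis.

Set Implicit Arguments.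
Unset Strict Implicit.
Unset Printing Implicit Defensive.

Export Order.TTheory GRing.Theory Num.Theory.
Export numFieldNormedType.Exports.

Local Open Scope classical_set_scope.
Local Open Scope ring_scope.

(* The tuple [k] lists the exponents k_1 > k_2 > ... > k_s >= 1. *)
Definition dyadic_sums (s : nat) : set nat :=
  [set n | exists k : s.-tuple nat,
    [/\ sorted gtn k, all (leq 1) k & n = (\sum_(j <- k) 2 ^ j)%N]].

Definition dyadic_sums_le (l : nat) : set nat :=
  \bigcup_(s in [set s : nat | (1 <= s <= l)%N]) dyadic_sums s.

(* An enumeration m_1, m_2, ... of [A]; the value [m 0] is irrelevant. *)
Definition enumeration (A : set nat) (m : nat -> nat) : Prop :=
  set_bij [set k : nat | (1 <= k)%N] A m.

(* e^{it} for real t *)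
Definition expi (R : realType) (t : R) : R[i] := (cos t +i* sin t)%C.

(* Main.v *)
Require Import Defs.
From mathcomp Require Import measurable_realfun zify ring lra.

(* Everything rests on the L^4 bound ||sum_k c_k e^{i m_k x}||_4 <= C ||c||_2 over a
   period.  Squaring the sum, it follows from Parseval once the number of solutions
   of n + n' = N with n, n' in D^*(l) is bounded independently of N.

   If sum |c_k|^2 converges, bisecting blocks of indices at half of their mass
   sum |c_k|^2 upgrades the L^4 bound to the maximal partial sum of a block, for
   any order of the terms; Markov's inequality then gives the Cauchy property a.e.

   Conversely, a.e. convergence bounds the partial sums S_n by a constant outside
   a set A of small measure.  Parseval computes the integral of |S_n|^2, and the
   L^4 bound makes the part of it over A at most half of the whole. *)

Local Open Scope classical_set_scope.
Local Open Scope ring_scope.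

(** * Sums of boundedly many powers of two *)

(** Candidates for the largest exponent in a sum [N] of at most [t] powers of two. The length is
    [t.+1] whatever [N] is, even where the truncated subtraction gives [0]. *)
Definition pow2_window (t N : nat) : seq nat := iota (trunc_log 2 N - t) t.+1.

Fixpoint pow2_subsums (t N : nat) : seq nat :=
  if t is t'.+1 then
    0%N :: flatten [seq [seq (2 ^ e + n)%N | n <- pow2_subsums t' (N - 2 ^ e)]
                     ++ pow2_subsums t' (N - 2 ^ e) | e <- pow2_window t N]
  else [:: 0%N].

Lemma pow2_subsumsS t N : pow2_subsums t.+1 N =
  0%N :: flatten [seq [seq (2 ^ e + n)%N | n <- pow2_subsums t (N - 2 ^ e)]
                   ++ pow2_subsums t (N - 2 ^ e) | e <- pow2_window t.+1 N].
Proof. by []. Qed.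

Fixpoint pow2_subsums_bound (t : nat) : nat :=
  if t is t'.+1 then (t.+1 * (2 * pow2_subsums_bound t')).+1 else 1%N.

Lemma size_pow2_subsums t N : size (pow2_subsums t N) = pow2_subsums_bound t.
Proof.
elim: t N => // t IH N; rewrite pow2_subsumsS.
rewrite -[LHS]/((size (flatten _)).+1) size_flatten /shape.
rewrite -map_comp [RHS]/=; congr _.+1.
(* Writing [t.+2] as the length of the window lets the induction run over an arbitrary list of
   exponents. *)
rewrite -[in RHS](size_iota (trunc_log 2 N - t.+1) t.+2).
rewrite /pow2_window; elim: (iota _ _) => // e s /= ->.
by rewrite size_cat size_map !IH; lia.
Qed.

(** The bound [N <= t * 2 ^ e < 2 ^ (t + e)] keeps the logarithm of [N] below [t + e]. *)
Lemma mem_pow2_window t N e :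
  (2 ^ e <= N)%N -> (N <= t * 2 ^ e)%N -> e \in pow2_window t N.
Proof.
move=> eN Nt; rewrite mem_iota.
have N0 : (0 < N)%N by apply: leq_trans eN; rewrite expn_gt0.
have le : (e <= trunc_log 2 N)%N by apply: trunc_log_max.
have lt : (trunc_log 2 N < t + e)%N.
  rewrite -(ltn_exp2l _ _ (isT : 1 < 2)%N).
  apply: leq_ltn_trans (trunc_logP _ N0) _ => //.
  apply: leq_ltn_trans Nt _; rewrite expnD ltn_pmul2r ?expn_gt0 //.
  exact: ltn_expl.
lia.
Qed.

Lemma sum_rem (e : nat) (s : seq nat) : e \in s ->
  (\sum_(j <- s) 2 ^ j = 2 ^ e + \sum_(j <- rem e s) 2 ^ j)%N.
Proof. by move=> es; rewrite (perm_big _ (perm_to_rem es)) big_cons. Qed.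

Lemma max_exponent (s : seq nat) : s != [::] ->
  exists2 e, e \in s & forall j, j \in s -> (j <= e)%N.
Proof.
elim: s => // a s IH _; have [->|/IH [e es He]] := eqVneq s [::].
  by exists a; rewrite ?mem_head // => j; rewrite inE => /eqP ->.
have [ae|ea] := leqP a e.
  by exists e; rewrite ?inE ?es ?orbT // => j /[!inE] /orP[/eqP ->|/He].
exists a; rewrite ?mem_head // => j /[!inE] /orP[/eqP ->//|/He je].
exact: leq_trans je (ltnW ea).
Qed.

Lemma sum_pow2_le (e : nat) (s : seq nat) : (forall j, j \in s -> (j <= e)%N) ->
  (\sum_(j <- s) 2 ^ j <= size s * 2 ^ e)%N.
Proof.
elim: s => [|a s IH] H; first by rewrite big_nil.
rewrite big_cons /= mulSn leq_add ?leq_exp2l ?H ?mem_head //.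
by apply: IH => j js; apply: H; rewrite inE js orbT.
Qed.

(* The largest exponent of a sum N of at most t powers of two lies within t
   of log2 N, so it can be chosen in boundedly many ways, and then removed. *)
Lemma mem_pow2_subsums t (s1 s2 : seq nat) : (size s1 + size s2 <= t)%N ->
  (\sum_(j <- s1) 2 ^ j)%N
    \in pow2_subsums t (\sum_(j <- s1) 2 ^ j + \sum_(j <- s2) 2 ^ j).
Proof.
elim: t s1 s2 => [|t IH] s1 s2 st.
  have -> : s1 = [::] by apply: size0nil; lia.
  by rewrite big_nil mem_head.
have [s0|s12] := eqVneq (s1 ++ s2) [::].
  have -> : s1 = [::] by case: s1 s0 {st}.
  by rewrite big_nil mem_head.
have [e es eM] := max_exponent _ s12.
set N := (_ + _)%N.
have NE : (N = \sum_(j <- s1 ++ s2) 2 ^ j)%N by rewrite big_cat.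
have eW : e \in pow2_window t.+1 N.
  apply: mem_pow2_window; rewrite NE.
    by rewrite (sum_rem _ _ es) leq_addr.
  apply: leq_trans (sum_pow2_le _ _ eM) _.
  by rewrite leq_mul2r size_cat st orbT.
rewrite pow2_subsumsS inE; apply/orP; right; apply/flatten_mapP.
exists e => //; rewrite mem_cat; apply/orP.
move: es; rewrite mem_cat => /orP[e1|e2]; [left|right].
  apply/mapP; exists (\sum_(j <- rem e s1) 2 ^ j)%N; last exact: sum_rem.
  rewrite /N (sum_rem _ _ e1) -addnA addKn; apply: IH.
  by rewrite size_rem //; case: s1 e1 st {s12 eM N NE eW}.
rewrite /N (sum_rem _ _ e2) addnCA addKn; apply: IH.
by rewrite size_rem //; case: s2 e2 st {s12 eM N NE eW} => //= a s _; rewrite addnS.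
Qed.

Lemma dyadic_subsums l (n1 n2 : nat) :
  dyadic_sums_le l n1 -> dyadic_sums_le l n2 ->
  n1 \in pow2_subsums (l + l) (n1 + n2).
Proof.
move=> [s1 /andP[_ hs1] [k1 [_ _ ->]]] [s2 /andP[_ hs2] [k2 [_ _ ->]]].
by apply: mem_pow2_subsums; rewrite !size_tuple leq_add.
Qed.

(** A solution of [m j + m k = N] is determined by the value [m j], by injectivity, and all these
    values lie in one list whose length does not depend on [N]. *)
Lemma dyadic_add_count l (m : nat -> nat) (r : seq nat) (N : nat) : uniq r ->
  {in r &, injective m} -> {in r, forall k, dyadic_sums_le l (m k)} ->
  (count (fun p => m p.1 + m p.2 == N)%N [seq (j, k) | j <- r, k <- r]
     <= pow2_subsums_bound (l + l))%N.
Proof.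
move=> ur mI mD; rewrite -(size_pow2_subsums (l + l) N) -size_filter.
rewrite -(size_map (fun p => m p.1)); apply: uniq_leq_size.
  rewrite map_inj_in_uniq ?filter_uniq ?allpairs_uniq //; first by move=> [? ?] [].
  move=> p q; rewrite !mem_filter => /andP[/eqP hp +] /andP[/eqP hq +].
  move=> /allpairsP[[j k] /= [jr kr ep]] /allpairsP[[j' k'] /= [jr' kr' eq]].
  rewrite {p}ep {q}eq /= in hp hq * => mj.
  by congr pair; apply: mI => //; lia.
move=> n /mapP[p]; rewrite mem_filter => /andP[/eqP <-].
by move=> /allpairsP[[j k] /= [jr kr ->]] ->; apply: dyadic_subsums; apply: mD.
Qed.

(** * Trigonometric sums over a period *)

Section ComplexNorm.
Context {R : realType}.
Implicit Types z w : R[i].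

(** The squared modulus as a real number; the norm on [R[i]] takes its values in [R[i]]. *)
Definition sqnorm z : R := complex.Re z ^+ 2 + complex.Im z ^+ 2.

Lemma sqnorm_ge0 z : 0 <= sqnorm z.
Proof. by rewrite addr_ge0 ?sqr_ge0. Qed.

Lemma sqnormE z : sqnorm z = Normc.normc z ^+ 2.
Proof. by case: z => a b; rewrite /= sqr_sqrtr // addr_ge0 ?sqr_ge0. Qed.

Lemma sqnormM z w : sqnorm (z * w) = sqnorm z * sqnorm w.
Proof. by rewrite !sqnormE Normc.normcM exprMn. Qed.

Lemma ReD z w : complex.Re (z + w) = complex.Re z + complex.Re w.
Proof. by case: z; case: w. Qed.

Lemma ImD z w : complex.Im (z + w) = complex.Im z + complex.Im w.
Proof. by case: z; case: w. Qed.

Lemma Re_sum T (r : seq T) (v : T -> R[i]) :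
  complex.Re (\sum_(p <- r) v p) = \sum_(p <- r) complex.Re (v p).
Proof. by elim/big_rec2: _ => // p y z _ <-; exact: ReD. Qed.

Lemma Im_sum T (r : seq T) (v : T -> R[i]) :
  complex.Im (\sum_(p <- r) v p) = \sum_(p <- r) complex.Im (v p).
Proof. by elim/big_rec2: _ => // p y z _ <-; exact: ImD. Qed.

Lemma sqnorm_conj z : sqnorm z = complex.Re (z * conjc z).
Proof. by case: z => a b; rewrite /sqnorm /=; ring. Qed.

Lemma sqnorm_sum T (r : seq T) (v : T -> R[i]) :
  sqnorm (\sum_(p <- r) v p) =
  \sum_(p <- r) \sum_(q <- r) complex.Re (v p * conjc (v q)).
Proof.
rewrite sqnorm_conj rmorph_sum mulr_suml Re_sum; apply: eq_bigr => p _.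
by rewrite mulr_sumr Re_sum.
Qed.

Lemma Re_mul_conj_le z w : complex.Re (z * conjc w) <= (sqnorm z + sqnorm w) / 2.
Proof.
case: z w => a b [c d]; rewrite /sqnorm /=.
have := sqr_ge0 (a - c); have := sqr_ge0 (b - d); lra.
Qed.

(** The coefficient of [w] has to be small: in the maximal inequality each half of a block carries
    at most 1/4 of the squared mass, and 1/4 + 2/4 < 1 leaves room for the term with 216. *)
Lemma sqnormD_le2 z w :
  sqnorm (z + w) ^+ 2 <= 216 * sqnorm z ^+ 2 + 2 * sqnorm w ^+ 2.
Proof.
have := sqnorm_ge0 z; have := sqnorm_ge0 w; have := sqnorm_ge0 (z + w).
(* The weighted inequality |z + w|^2 <= (1 + 1/d) |z|^2 + (1 + d) |w|^2 with d = 1/5. *)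
have : sqnorm (z + w) <= 6 * sqnorm z + 6 / 5 * sqnorm w.
  case: z w => a b [c d]; rewrite /sqnorm /=.
  have := sqr_ge0 (5 * a - c); have := sqr_ge0 (5 * b - d); lra.
move: (sqnorm _) (sqnorm z) (sqnorm w) => s x y *.
have : s ^+ 2 <= (6 * x + 6 / 5 * y) ^+ 2 by rewrite ler_sqr // nnegrE; lra.
have := sqr_ge0 (12 * x - 3 / 5 * y).
have := sqr_ge0 x; have := sqr_ge0 y; lra.
Qed.

Lemma Re_mul_expi z w (s t : R) :
  complex.Re ((z * expi s) * conjc (w * expi t)) =
  complex.Re (z * conjc w) * cos (s - t) - complex.Im (z * conjc w) * sin (s - t).
Proof. by case: z w => a b [c d]; rewrite cosB sinB /=; ring. Qed.

Lemma expiD (s t : R) : expi (s + t) = expi s * expi t.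
Proof. by rewrite /expi cosD sinD [sin s * cos t + _]addrC. Qed.

End ComplexNorm.

(** * Parseval's identity and a Bessel inequality with multiplicity *)

Section TrigIntegral.
Context {R : realType}.
Local Notation mu := [the measure _ _ of @lebesgue_measure R].
Implicit Types (a x : R) (n : nat).

Definition period a : set R := `[a, a + pi *+ 2].

Lemma measurable_period a : measurable (period a).
Proof. exact: measurable_itv. Qed.

Lemma cos_periodic n x : cos (n%:R * (x + pi *+ 2)) = cos (n%:R * x).
Proof. by rewrite mulrDr mulr_natl mulr_natl (periodicn (@cosD2pi R)). Qed.

Lemma sin_periodic n x : sin (n%:R * (x + pi *+ 2)) = sin (n%:R * x).
Proof. by rewrite mulrDr mulr_natl mulr_natl (periodicn (@sinD2pi R)). Qed.

Lemma pi2_gt0 : 0 < pi *+ 2 :> R.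
Proof. by rewrite pmulrn_lgt0 // pi_gt0. Qed.

Lemma measure_period a : mu (period a) = (pi *+ 2)%:E.
Proof.
rewrite [LHS]lebesgue_measure_itv /= lte_fin ltrDl pi2_gt0.
by rewrite -EFinB addrAC subrr add0r.
Qed.

Lemma continuous_trig (A B s t : R) :
  continuous (fun x : R => A * cos (s * x - t * x) - B * sin (s * x - t * x) : R).
Proof.
move=> x.
apply: differentiable_continuous; apply/derivable1_diffP; exact: ex_derive.
Qed.

Lemma integral_trig a (A B : R) n n' :
  (\int[mu]_(x in period a)
     (A * cos (n%:R * x - n'%:R * x) - B * sin (n%:R * x - n'%:R * x))%:E)%E
  = (if n == n' then (pi *+ 2) * A else 0)%:E.
Proof.
have [->|nn] := eqVneq n n'.
  under eq_integral do rewrite subrr cos0 sin0 mulr1 mulr0 subr0.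
  rewrite integral_cst; last exact: measurable_period.
  by rewrite measure_period -EFinM mulrC.
pose k : R := n%:R - n'%:R.
have k0 : k != 0 by rewrite subr_eq0 eqr_nat.
pose F x : R := k^-1 * (A * sin (n%:R * x - n'%:R * x) + B * cos (n%:R * x - n'%:R * x)).
have dF x : is_derive x 1 F (A * cos (n%:R * x - n'%:R * x) - B * sin (n%:R * x - n'%:R * x)).
  rewrite /F; apply: is_derive_eq; rewrite /GRing.scale /=.
by rewrite !mulr1 -/k; field.
rewrite (@continuous_FTC2 _ _ F).
(* The addition formulas reduce the periodicity of [F] to that of sine and cosine at the natural
   frequencies [n] and [n'], although [n - n'] may be negative. *)
- by rewrite /F !sinB !cosB !cos_periodic !sin_periodic subee.
- by rewrite ltrDl pi2_gt0.
- apply: continuous_subspaceT; exact: continuous_trig.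
- split.
  + by move=> x _; exact: ex_derive.
  + apply: cvg_at_right_filter.
    apply: differentiable_continuous; apply/derivable1_diffP; exact: ex_derive.
  + apply: cvg_at_left_filter.
    apply: differentiable_continuous; apply/derivable1_diffP; exact: ex_derive.
- by move=> x _; rewrite derive1E; exact: derive_val.
Qed.

Lemma integrable_trig a (A B s t : R) : mu.-integrable (period a)
  (fun x => (A * cos (s * x - t * x) - B * sin (s * x - t * x))%:E).
Proof.
apply: continuous_compact_integrable; first exact: segment_compact.
by apply: continuous_subspaceT; exact: continuous_trig.
Qed.

(** The index type is arbitrary and frequencies may coincide, so that the square of such a sum,
    indexed by pairs, is again of this form. *)
Definition trig_sum {T} (r : seq T) (n : T -> nat) (u : T -> R[i]) x : R[i] :=
  \sum_(p <- r) u p * expi ((n p)%:R * x).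

Lemma parseval T (r : seq T) (n : T -> nat) (u : T -> R[i]) a :
  (\int[mu]_(x in period a) (sqnorm (trig_sum r n u x))%:E)%E =
  ((pi *+ 2) * \sum_(p <- r) \sum_(q <- r | n p == n q)
                  complex.Re (u p * conjc (u q)))%:E.
Proof.
pose A p q := complex.Re (u p * conjc (u q)).
pose B p q := complex.Im (u p * conjc (u q)).
pose f p q x := (A p q * cos ((n p)%:R * x - (n q)%:R * x)
                 - B p q * sin ((n p)%:R * x - (n q)%:R * x))%:E.
have fi p q : mu.-integrable (period a) (f p q) by exact: integrable_trig.
transitivity (\int[mu]_(x in period a) \sum_(p <- r) \sum_(q <- r) f p q x)%E.
  apply: eq_integral => x _; rewrite sqnorm_sum -sumEFin; apply: eq_bigr => p _.
  by rewrite -sumEFin; apply: eq_bigr => q _; rewrite Re_mul_expi.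
rewrite integral_sum //; last 2 first.
- exact: measurable_period.
- by move=> p; apply: integrable_sum => //; exact: measurable_period.
rewrite mulr_sumr -sumEFin; apply: eq_bigr => p _.
rewrite integral_sum //; last exact: measurable_period.
rewrite mulr_sumr -sumEFin [RHS]big_mkcond; apply: eq_bigr => q _.
by rewrite integral_trig; case: ifP.
Qed.

Lemma parseval_inj (T : eqType) (r : seq T) (n : T -> nat) (u : T -> R[i]) a :
  uniq r -> {in r &, injective n} ->
  (\int[mu]_(x in period a) (sqnorm (trig_sum r n u x))%:E)%E =
  ((pi *+ 2) * \sum_(p <- r) sqnorm (u p))%:E.
Proof.
move=> ur nI; rewrite parseval; congr (_ * _)%:E.
apply: eq_big_seq => p pr; rewrite (big_rem p) //= eqxx -sqnorm_conj.
rewrite big_seq_cond big1 ?addr0 // => q /andP[qr /eqP npq].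
move: qr; rewrite mem_rem_uniq // inE => /andP[/eqP qp qr].
by case: qp; apply/esym/nI.
Qed.

(** In Parseval's double sum each cross term is at most half the sum of two squared moduli, and each
    index meets at most [B] indices of the same frequency. *)
Lemma bessel_multiplicity (T : eqType) (r : seq T) (n : T -> nat) (u : T -> R[i]) a (B : nat) :
  (forall N, (count (fun p => n p == N) r <= B)%N) ->
  (\int[mu]_(x in period a) (sqnorm (trig_sum r n u x))%:E <=
   ((pi *+ 2) * (B%:R * \sum_(p <- r) sqnorm (u p)))%:E)%E.
Proof.
move=> nB; rewrite parseval lee_fin ler_pM2l ?pi2_gt0 //.
pose S := \sum_(p <- r) \sum_(q <- r | n p == n q) sqnorm (u p).
have SB : S <= B%:R * \sum_(p <- r) sqnorm (u p).
  rewrite /S mulr_sumr; apply: ler_sum => p _.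
  rewrite big_const_seq iter_addr_0 -[leLHS]mulr_natl ler_wpM2r ?sqnorm_ge0 //.
  by rewrite ler_nat; apply: leq_trans (nB (n p)); under eq_count do rewrite eq_sym.
apply: le_trans SB.
have S' : S = \sum_(p <- r) \sum_(q <- r | n p == n q) sqnorm (u q).
  rewrite /S (exchange_big_dep predT) //=; apply: eq_bigr => p _; apply: eq_bigl => q.
  by rewrite eq_sym.
(* One copy of [S] is read with [u p] and the other with [u q], which matches the half-sum in
   [Re_mul_conj_le]. *)
rewrite (_ : S = (S + S) / 2); last by field.
rewrite {2}S' -big_split mulr_suml; apply: ler_sum => p _.
rewrite -big_split mulr_suml; apply: ler_sum => q _.
exact: Re_mul_conj_le.
Qed.

Lemma measurable_trig_sum T (r : seq T) (n : T -> nat) (u : T -> R[i]) (D : set R) :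
  measurable_fun D (fun x => complex.Re (trig_sum r n u x)) /\
  measurable_fun D (fun x => complex.Im (trig_sum r n u x)).
Proof.
have mt (A B s : R) :
    measurable_fun D (fun x => A * cos (s * x) - B * sin (s * x) : R).
  apply: measurable_funTS; apply: continuous_measurable_fun => x.
  by apply: differentiable_continuous; apply/derivable1_diffP; exact: ex_derive.
split.
  under eq_fun do rewrite Re_sum; apply: measurable_sum => p.
  rewrite (_ : (fun x => _) = fun x =>
    complex.Re (u p) * cos ((n p)%:R * x) - complex.Im (u p) * sin ((n p)%:R * x)) //.
  by apply/funext => x; case: (u p).
under eq_fun do rewrite Im_sum; apply: measurable_sum => p.
rewrite (_ : (fun x => _) = fun x =>
  complex.Im (u p) * cos ((n p)%:R * x) - - complex.Re (u p) * sin ((n p)%:R * x)) //.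
by apply/funext => x; case: (u p) => ? ?; rewrite /= mulNr opprK addrC.
Qed.

Lemma measurable_sqnorm_trig_sum T (r : seq T) (n : T -> nat) (u : T -> R[i]) (D : set R) :
  measurable_fun D (fun x => sqnorm (trig_sum r n u x)).
Proof.
have [mR mI] := measurable_trig_sum T r n u D.
by apply: measurable_funD; apply: measurable_funX.
Qed.

End TrigIntegral.

(** * The L^4 bound and the maximal inequality *)

Section Maximal.
Context {R : realType}.
Local Notation mu := [the measure _ _ of @lebesgue_measure R].
Implicit Types (a x : R) (c : nat -> R[i]) (m : nat -> nat) (r : seq nat).

(** A Sidon-type condition on the frequencies, with ordered pairs counted; it is the arithmetic
    input of the L^4 bound. *)
Definition additive_multiplicity_le (B : nat) (m : nat -> nat) (r : seq nat) :=
  forall N, (count (fun p => m p.1 + m p.2 == N)%N [seq (j, k) | j <- r, k <- r]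
               <= B)%N.

Lemma additive_multiplicity_le_sub B m r r' : uniq r' -> {subset r' <= r} ->
  additive_multiplicity_le B m r -> additive_multiplicity_le B m r'.
Proof.
move=> ur' sr' h N; apply: leq_trans (h N).
rewrite -!size_filter; apply: uniq_leq_size.
  by rewrite filter_uniq // allpairs_uniq // => -[? ?] [].
move=> p; rewrite !mem_filter => /andP[-> /allpairsP[[j k] /= [jr kr ->]]].
by apply/allpairsP; exists (j, k); split => //=; apply: sr'.
Qed.

Lemma trig_sum_sqr m c r x : trig_sum r m c x ^+ 2 =
  trig_sum [seq (j, k) | j <- r, k <- r] (fun p => m p.1 + m p.2)%N
    (fun p => c p.1 * c p.2) x.
Proof.
rewrite /trig_sum big_allpairs expr2 mulr_suml; apply: eq_bigr => j _.
rewrite mulr_sumr; apply: eq_bigr => k _.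
by rewrite natrD mulrDl expiD mulrACA.
Qed.

(** Bessel's inequality for the squared sum: its coefficients are the products [c j * c k], whose
    squared moduli add up to the square of the mass. *)
Lemma integral_L4_le B m c r a : additive_multiplicity_le B m r ->
  (\int[mu]_(x in period a) (sqnorm (trig_sum r m c x) ^+ 2)%:E <=
   ((pi *+ 2) * (B%:R * (\sum_(k <- r) sqnorm (c k)) ^+ 2))%:E)%E.
Proof.
move=> h; under eq_integral do rewrite expr2 -sqnormM -expr2 trig_sum_sqr.
apply: le_trans (bessel_multiplicity _ _ _ _ _ _ h) _.
rewrite lee_fin le_eqVlt; apply/orP; left; apply/eqP; congr (_ * (_ * _)).
rewrite big_allpairs expr2 mulr_suml; apply: eq_bigr => j _.
by rewrite mulr_sumr; apply: eq_bigr => k _; rewrite sqnormM.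
Qed.

(** The term [k] is the first one at which the running sum reaches half of the total. *)
Lemma split_half r (g : nat -> R) : (forall k, 0 <= g k) -> r != [::] ->
  exists r1 k r2, [/\ r = r1 ++ k :: r2,
    \sum_(i <- r1) g i <= (\sum_(i <- r) g i) / 2 &
    \sum_(i <- r2) g i <= (\sum_(i <- r) g i) / 2].
Proof.
move=> g0 r0; set s := \sum_(i <- r) g i.
have s0 : 0 <= s by apply: sumr_ge0.
have ex : exists j, s <= 2 * \sum_(i <- take j.+1 r) g i.
  by exists (size r); rewrite take_oversize // -/s; lra.
have [j hj jmin] := ex_minnP ex.
have jr : (j < size r)%N.
  rewrite ltnNge; apply/negP => rj.
  have : ((size r).-1 < j)%N by rewrite prednK // lt0n size_eq0.
  rewrite ltnNge => /negP; apply; apply: jmin.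
  rewrite prednK ?lt0n ?size_eq0 // take_size -/s; lra.
exists (take j r), (nth 0%N r j), (drop j.+1 r).
have rE : r = take j r ++ nth 0%N r j :: drop j.+1 r.
  by rewrite -drop_nth // cat_take_drop.
split=> //.
  case: j jmin {hj jr rE} => [|j] jmin.
    by rewrite take0 big_nil; lra.
  rewrite leNgt; apply/negP => h.
  have := jmin j; rewrite ltnn => H; suff: false by []; apply: H; lra.
have sE : s = \sum_(i <- take j.+1 r) g i + \sum_(i <- drop j.+1 r) g i.
  by rewrite -big_cat cat_take_drop.
by move: hj sE; lra.
Qed.

Lemma trig_sum_cat T (r1 r2 : seq T) n (u : T -> R[i]) x :
  trig_sum (r1 ++ r2) n u x = trig_sum r1 n u x + trig_sum r2 n u x.
Proof. exact: big_cat. Qed.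

(* The block is split at the term where half of its mass sum |c_k|^2 is reached:
   each half carries at most half the mass, so the squared masses on the right
   add up to less than the whole and the constant does not grow with r. *)
Lemma maximal_majorant B m c r a : uniq r -> additive_multiplicity_le B m r ->
  exists G : R -> R, [/\ measurable_fun setT G, forall x, 0 <= G x,
    forall j x, sqnorm (trig_sum (take j r) m c x) ^+ 2 <= G x &
    (\int[mu]_(x in period a) (G x)%:E <=
     (864 * (pi *+ 2 * B%:R) * (\sum_(k <- r) sqnorm (c k)) ^+ 2)%:E)%E].
Proof.
have [n] := ubnP (size r); elim: n r => // n IH r.
rewrite ltnS => rn ur hr.
have [r0|r0] := eqVneq r [::].
  exists (fun=> 0); split=> //.
    by move=> j x; rewrite r0 /trig_sum /= big_nil /sqnorm /=; lra.
  by rewrite integral0 lee_fin r0 big_nil; lra.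
have [r1 [k [r2 [rE h1 h2]]]] :=
  split_half r (fun k => sqnorm (c k)) (fun k => sqnorm_ge0 (c k)) r0.
move: h1 h2; set s := \sum_(i <- r) _ => h1 h2.
have [u1 u2 u3] : [/\ uniq r1, uniq r2 & uniq (rcons r1 k)].
  have := ur; rewrite rE -cat_rcons cat_uniq => /and3P[? _ ->]; split => //.
  by move: ur; rewrite rE cat_uniq => /andP[].
have sub1 : {subset r1 <= r} by move=> i; rewrite rE mem_cat => ->.
have sub2 : {subset r2 <= r} by move=> i; rewrite rE mem_cat inE => ->; rewrite !orbT.
have sub3 : {subset rcons r1 k <= r} by move=> i; rewrite rE -cat_rcons mem_cat => ->.
have sz : (size r1 + size r2 < n)%N by move: rn; rewrite rE size_cat /= addnS.
have [G1 [mG1 G10 G1S G1i]] := IH r1 (leq_ltn_trans (leq_addr _ _) sz) u1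
  (additive_multiplicity_le_sub _ _ _ _ u1 sub1 hr).
have [G2 [mG2 G20 G2S G2i]] := IH r2 (leq_ltn_trans (leq_addl _ _) sz) u2
  (additive_multiplicity_le_sub _ _ _ _ u2 sub2 hr).
pose G3 x := sqnorm (trig_sum (rcons r1 k) m c x) ^+ 2.
have mG3 : measurable_fun setT G3.
  by apply: measurable_funX; exact: measurable_sqnorm_trig_sum.
have G30 x : 0 <= G3 x by rewrite sqr_ge0.
have G3i := integral_L4_le B m c (rcons r1 k) a
  (additive_multiplicity_le_sub _ _ _ _ u3 sub3 hr).
(* A partial sum either stops within [r1], or is the full sum over [rcons r1 k] plus a partial sum
   of [r2]; in the latter case [sqnormD_le2] supplies the weights 216 and 2. *)
exists (fun x => G1 x + (2 * G2 x + 216 * G3 x)); split.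
- apply: measurable_funD => //.
  apply: measurable_funD; apply: measurable_funM => //.
- by move=> x; rewrite !addr_ge0 // mulr_ge0.
- move=> j x; have := G10 x; have := G20 x; have := G30 x => x3 x2 x1.
  have [jr|jr] := leqP j (size r1).
    rewrite rE takel_cat //; have := G1S j x; lra.
  have -> : take j r = rcons r1 k ++ take (j - (size r1).+1) r2.
    by rewrite rE -cat_rcons take_cat size_rcons ltnNge jr.
  rewrite trig_sum_cat; apply: le_trans (sqnormD_le2 _ _) _.
  rewrite -/(G3 x); have := G2S (j - (size r1).+1)%N x; lra.
have mE (G : R -> R) : measurable_fun setT G ->
    measurable_fun (period a) (EFin \o G).
  by move=> mG; apply/measurable_EFinP; exact: measurable_funTS.
have mP := measurable_period a.
under eq_integral do rewrite 2!EFinD 2!EFinM.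
rewrite ge0_integralD //; last 4 first.
- by move=> x _; rewrite lee_fin.
- exact: mE.
- by move=> x _; rewrite adde_ge0 // mule_ge0 // lee_fin.
- apply: emeasurable_funD; apply: measurable_funeM; exact: mE.
rewrite ge0_integralD //; last 4 first.
- by move=> x _; rewrite mule_ge0 // lee_fin.
- by apply: measurable_funeM; exact: mE.
- by move=> x _; rewrite mule_ge0 // lee_fin.
- by apply: measurable_funeM; exact: mE.
rewrite !ge0_integralZl //; last 4 first.
- exact: mE.
- by move=> x _; rewrite lee_fin.
- exact: mE.
- by move=> x _; rewrite lee_fin.
have s3 : 0 <= \sum_(i <- rcons r1 k) sqnorm (c i) <= s.
  rewrite sumr_ge0 /=; last by move=> *; exact: sqnorm_ge0.
  rewrite /s rE -cat_rcons big_cat lerDl sumr_ge0 // => *; exact: sqnorm_ge0.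
have s1 : 0 <= \sum_(i <- r1) sqnorm (c i) by apply: sumr_ge0 => *; exact: sqnorm_ge0.
have s2 : 0 <= \sum_(i <- r2) sqnorm (c i) by apply: sumr_ge0 => *; exact: sqnorm_ge0.
have step (G : R -> R) (K : R) (t : R) : (0 <= K)%R ->
  (\int[mu]_(x in period a) (G x)%:E <= t%:E)%E ->
  (K%:E * \int[mu]_(x in period a) (G x)%:E <= (K * t)%:E)%E.
  by move=> K0 h; rewrite EFinM; apply: lee_wpmul2l => //; rewrite lee_fin.
apply: le_trans (leeD G1i (leeD (step _ 2 _ _ G2i) (step _ 216 _ _ G3i))) _ => //.
rewrite -!EFinD lee_fin.
move: s1 s2 s3 h1 h2; set t1 := \sum_(i <- r1) _; set t2 := \sum_(i <- r2) _.
set t3 := \sum_(i <- rcons r1 k) _ => s1 s2 /andP[s30 s3] h1 h2.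
have K0 : 0 <= pi *+ 2 * B%:R :> R by rewrite mulr_ge0 // ltW // pi2_gt0.
(* The constant closes the induction exactly: 864/4 + 2 * 864/4 + 216 = 864. *)
have e1 : t1 ^+ 2 <= s ^+ 2 / 4 by nra.
have e2 : t2 ^+ 2 <= s ^+ 2 / 4 by nra.
have e3 : t3 ^+ 2 <= s ^+ 2 by nra.
rewrite [X in 216 * X]mulrA; move: (pi *+ 2 * B%:R) K0 => K K0.
have := ler_wpM2l K0 e1; have := ler_wpM2l K0 e2; have := ler_wpM2l K0 e3.
lra.
Qed.

End Maximal.

(** * Almost everywhere convergence *)

Section AlmostEverywhere.
Context {R : realType}.
Local Notation mu := [the measure _ _ of @lebesgue_measure R].
Implicit Types (a x : R) (c : nat -> R[i]) (m : nat -> nat).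

Lemma measurable_superlevel (f : R -> R) (D : set R) (e : R) :
  measurable D -> measurable_fun D f ->
  measurable (D `&` [set x | e < f x]).
Proof. by move=> mD mf; rewrite -preimage_itvoy; apply: mf. Qed.

Lemma markov_le (G : R -> R) (D A : set R) (e t : R) :
  measurable D -> measurable A -> A `<=` D -> measurable_fun D G ->
  (forall x, 0 <= G x) -> (forall x, A x -> e <= G x) -> 0 < e ->
  (\int[mu]_(x in D) (G x)%:E <= t%:E)%E -> (mu A <= (t / e)%:E)%E.
Proof.
move=> mD mA AD mG G0 eG e0 Gt.
have mGE : measurable_fun D (EFin \o G) by apply/measurable_EFinP.
rewrite -(@lee_pmul2l _ e%:E) ?lte_fin // -EFinM mulrC divfK ?gt_eqF //.
rewrite -(integral_cst mu mA); apply: le_trans Gt.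
apply: (@le_trans _ _ (\int[mu]_(x in A) (G x)%:E)%E).
  apply: ge0_le_integral => //.
  - by move=> x _; rewrite lee_fin ltW.
  - by apply: measurable_funS mGE.
by apply: ge0_subset_integral => // x _; rewrite lee_fin.
Qed.

(** The block starts right after index [N], and [e] is compared with fourth powers of the modulus,
    the quantity that the maximal inequality controls. *)
Definition deviation m c (N : nat) (e : R) a : set R :=
  period a `&`
    [set x | exists j, e < sqnorm (trig_sum (iota N.+1 j) m c x) ^+ 2].

Definition partial_deviation m c (N : nat) (e : R) a (J : nat) : set R :=
  \bigcup_(j in [set j | (j <= J)%N])
    (period a `&` [set x | e < sqnorm (trig_sum (iota N.+1 j) m c x) ^+ 2]).

Lemma measurable_partial_deviation m c N e a J :
  measurable (partial_deviation m c N e a J).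
Proof.
apply: bigcup_measurable => j _; apply: measurable_superlevel.
  exact: measurable_period.
by apply: measurable_funX; exact: measurable_sqnorm_trig_sum.
Qed.

Lemma deviationE m c N e a :
  deviation m c N e a = \bigcup_J partial_deviation m c N e a J.
Proof.
apply/seteqP; split=> x; last by move=> [J _ [j _ [px h]]]; split => //; exists j.
by move=> [px [j h]]; exists j => //; exists j => //=.
Qed.

Lemma measurable_deviation m c N e a : measurable (deviation m c N e a).
Proof.
by rewrite deviationE; apply: bigcupT_measurable => J; exact: measurable_partial_deviation.
Qed.

Definition maximal_constant (B : nat) : R := 864 * (pi *+ 2 * B%:R).

Lemma maximal_constant_ge0 B : 0 <= maximal_constant B.
Proof. by apply: mulr_ge0; [exact: ler0n|rewrite mulr_ge0 ?ler0n ?ltW ?pi2_gt0]. Qed.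

(** For blocks of length at most [J] this is Markov's inequality applied to the maximal majorant;
    continuity of the measure from below then removes [J]. *)
Lemma measure_deviation_le m c B N (e d : R) a :
  (forall n, additive_multiplicity_le B m (iota 1 n)) -> 0 < e ->
  (forall j, \sum_(k <- iota N.+1 j) sqnorm (c k) <= d) ->
  (mu (deviation m c N e a) <= (maximal_constant B * d ^+ 2 / e)%:E)%E.
Proof.
move=> hB e0 hd; rewrite deviationE.
have nd : nondecreasing_seq (partial_deviation m c N e a).
  move=> I J IJ; apply/subsetPset => x [j jI h]; exists j => //=.
  exact: leq_trans IJ.
have mu_cvg := @nondecreasing_cvg_mu _ _ _ mu _ (measurable_partial_deviation m c N e a)
  (bigcupT_measurable _ (measurable_partial_deviation m c N e a)) nd.
rewrite -(cvg_lim _ mu_cvg) //; apply: lime_le; first exact: cvgP mu_cvg.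
near=> J; rewrite /=.
have hJ : additive_multiplicity_le B m (iota N.+1 J).
  apply: additive_multiplicity_le_sub (hB (N + J)%N); first exact: iota_uniq.
  by move=> k; rewrite !mem_iota; lia.
have [G [mG G0 GS Gi]] := maximal_majorant B m c _ a (iota_uniq N.+1 J) hJ.
apply: (markov_le G (period a)) => //.
- exact: measurable_period.
- exact: measurable_partial_deviation.
- by move=> x [j _ []].
- exact: measurable_funTS.
- move=> x [j /= jJ [_ /= /ltW h]]; apply: le_trans h _.
  by have := GS j x; rewrite take_iota (minn_idPl jJ).
apply: le_trans Gi _; rewrite lee_fin ler_wpM2l ?maximal_constant_ge0 //.
rewrite ler_sqr ?nnegrE ?hd //; first by apply: sumr_ge0 => *; exact: sqnorm_ge0.
by apply: le_trans (hd 0%N); rewrite big_nil.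
Unshelve. all: end_near. Qed.

(** The Cauchy property of the partial sums at [x], stated with fourth powers of the modulus. *)
Definition tails_vanish m c x := forall e : R, 0 < e -> exists N, forall j,
  sqnorm (trig_sum (iota N.+1 j) m c x) ^+ 2 <= e.

Lemma negligible_cover (A : set R) :
  (forall a, mu.-negligible (period a `&` A)) -> mu.-negligible A.
Proof.
move=> h.
(* Periods to the right of 0 and periods to the left of 0 together cover the line. *)
pose F k := period ((pi *+ 2) * k%:R) `&` A.
pose F' k := period (- ((pi *+ 2) * k.+1%:R)) `&` A.
apply: (@negligibleS _ _ _ mu (\bigcup_k F k `|` \bigcup_k F' k)); last first.
  by apply: negligibleU; apply: negligible_bigcup => k; exact: h.
have key (y : R) : 0 <= y -> exists k, (pi *+ 2) * k%:R <= y < (pi *+ 2) * k.+1%:R.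
  move=> y0; exists (Num.truncn (y / (pi *+ 2))).
  have /truncn_itv : 0 <= y / (pi *+ 2) by rewrite divr_ge0 // ltW // pi2_gt0.
  by rewrite ler_pdivlMr ?ltr_pdivrMr ?pi2_gt0 // !(mulrC (pi *+ 2)).
move=> x Ax; have [x0|x0] := leP 0 x.
  have [k /andP[h1 h2]] := key _ x0; left; exists k => //; split => //.
  rewrite /period /= in_itv /= h1 /=; move: h2; rewrite -(natr1 k) mulrDr mulr1; exact: ltW.
have [k /andP[h1 h2]] : exists k, (pi *+ 2) * k%:R <= - x < (pi *+ 2) * k.+1%:R.
  by apply: key; lra.
right; exists k => //; split => //; rewrite /period /= in_itv /=.
move: h1 h2; rewrite -(natr1 k) mulrDr mulr1; lra.
Qed.

(** Take [N] for which the partial sum is within [d] of the supremum of all partial sums. *)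
Lemma bounded_tail (g : nat -> R) (M d : R) : (forall k, 0 <= g k) ->
  (forall n, \sum_(k <- iota 1 n) g k <= M) -> 0 < d ->
  exists N, forall j, \sum_(k <- iota N.+1 j) g k <= d.
Proof.
move=> g0 gM d0; pose E := range (fun n => \sum_(k <- iota 1 n) g k).
have hE : has_sup E.
  by split; [exists (\sum_(k <- iota 1 0) g k), 0%N | exists M => _ [n _ <-]].
have [_ [N _ <-] hN] := sup_adherent d0 hE; exists N => j.
have : \sum_(k <- iota 1 (N + j)) g k <= sup E.
  by apply: ub_le_sup; [case: hE|exists (N + j)%N].
rewrite iotaD big_cat /= add1n; move: hN; lra.
Qed.

(** Where the tails do not vanish, some threshold [1 / (i + 1)] is exceeded after every [N]; the
    measure of that deviation set is made arbitrarily small by choosing [N] with little mass beyond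
    it. *)
Lemma negligible_non_vanishing m c B (M : R) :
  (forall n, additive_multiplicity_le B m (iota 1 n)) ->
  (forall n, \sum_(k <- iota 1 n) sqnorm (c k) <= M) ->
  mu.-negligible [set x | ~ tails_vanish m c x].
Proof.
move=> hB hM; apply: negligible_cover => a.
pose F i := \bigcap_N deviation m c N i.+1%:R^-1 a.
apply: (@negligibleS _ _ _ mu (\bigcup_i F i)).
  move=> x [px nv]; apply: contrapT => nF; apply: nv => e e0.
  have [i ie] : exists i, i.+1%:R^-1 <= e.
    have h : e^-1 < (Num.bound e^-1)%:R by rewrite archi_boundP // invr_ge0 ltW.
    exists (Num.bound e^-1); rewrite -[leRHS]invrK lef_pV2 ?posrE ?invr_gt0 //.
    by apply: le_trans (ltW h) _; rewrite ler_nat.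
  apply: contrapT => nN; apply: nF; exists i => // N _; split => //.
  apply: contrapT => nj; apply: nN; exists N => j; apply: le_trans ie.
  by rewrite leNgt; apply/negP => h; apply: nj; exists j.
apply: negligible_bigcup => i.
have mF : measurable (F i).
  by apply: bigcapT_measurable => N; exact: measurable_deviation.
apply/negligibleP => //; apply/eqP; rewrite -measure_le0; apply/lee_addgt0Pr => d d0.
rewrite add0e.
set e : R := i.+1%:R^-1; have e0 : 0 < e by rewrite invr_gt0.
pose K := maximal_constant B; have K0 : 0 <= K by exact: maximal_constant_ge0.
(* With [d' <= 1], K d'^2 <= (K + 1) d' <= d e; the added 1 avoids a division by zero. *)
pose d' := Num.min 1 (d * e / (K + 1)).
have d'0 : 0 < d' by rewrite lt_min ltr01 divr_gt0 ?mulr_gt0 //; lra.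
have [N hN] := bounded_tail _ _ _ (fun k => sqnorm_ge0 (c k)) hM d'0.
apply: (@le_trans _ _ (mu (deviation m c N e a))).
  apply: le_measure; rewrite ?inE //; first exact: measurable_deviation.
  by move=> x; exact.
apply: le_trans (measure_deviation_le m c B N e d' a hB e0 hN) _.
rewrite lee_fin ler_pdivrMr // -/K.
have d'1 : d' <= 1 by rewrite ge_min lexx.
have : d' <= d * e / (K + 1) by rewrite ge_min lexx orbT.
rewrite ler_pdivlMr ?ltr_wpDl // => h.
have : K * d' ^+ 2 <= K * d' by rewrite ler_wpM2l // expr2 ler_piMr // ltW.
lra.
Qed.

End AlmostEverywhere.

(** * From vanishing tails to convergence, and from convergence to square summability *)

Section Convergence.
Context {R : realType}.
Local Notation mu := [the measure _ _ of @lebesgue_measure R].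
Implicit Types (a x : R) (c : nat -> R[i]) (m : nat -> nat).

Lemma cauchy_tail_cvgn (u : nat -> R) :
  (forall e, 0 < e -> exists N, forall j, `|u (N + j)%N - u N| <= e) -> cvgn u.
Proof.
move=> h; apply/cauchy_cvgP; apply: cauchy_exP => e e0.
have [N hN] := h (e / 2) (divr_gt0 e0 (ltr0Sn _ 1)); exists (u N).
exists N => // n /= Nn; rewrite /ball /= distrC.
have := hN (n - N)%N; rewrite subnKC // => H; apply: le_lt_trans H _; lra.
Qed.

Lemma sqnorm_lt (z : R[i]) (e : R) : 0 < e -> (`|z| < e%:C%C) = (sqnorm z < e ^+ 2).
Proof.
move=> e0; rewrite normc_def ltcR -/(sqnorm z).
by rewrite -[e in LHS](@ger0_norm _ e) ?ltW // -sqrtr_sqr ltr_sqrt // exprn_gt0.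
Qed.

Lemma complex_cvgn (u : nat -> R[i]) :
  cvgn (fun n => complex.Re (u n)) -> cvgn (fun n => complex.Im (u n)) ->
  cvgn (u : nat -> (R[i])^o).
Proof.
move=> /cvg_ex[/= p up] /cvg_ex[/= q uq]; apply/cvg_ex; exists (p +i* q)%C.
(* A positive element of [R[i]] has zero imaginary part, so the radius is real. *)
apply/cvgrPdist_lt => -[e e'] /=; rewrite ltcE /= => /andP[/eqP -> e0].
have e20 : 0 < e / 2 by rewrite divr_gt0.
move/cvgrPdist_lt : up => /(_ _ e20) up; move/cvgrPdist_lt : uq => /(_ _ e20) uq.
near=> n; rewrite (_ : (e +i* 0)%C = e%:C%C) // sqnorm_lt //.
have hp : `|p - complex.Re (u n)| < e / 2 by near: n.
have hq : `|q - complex.Im (u n)| < e / 2 by near: n.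
move: hp hq; case: (u n) => s t /=; rewrite !ltr_norml /sqnorm /= => /andP[? ?] /andP[? ?].
nra.
Unshelve. all: end_near. Qed.

Lemma cvgn_eventually_bounded (u : nat -> R[i]) : cvgn (u : nat -> (R[i])^o) ->
  exists N, forall n, (N <= n)%N -> sqnorm (u n) <= N%:R.
Proof.
move=> /cvg_ex[/= L /cvgrPdist_lt /(_ 1 ltr01) [N _ hN]].
(* From |u|^2 <= 2 |L|^2 + 2 |L - u|^2 with |L - u| < 1. *)
pose M := 2 * sqnorm L + 2.
exists (maxn N (Num.bound M)) => n; rewrite geq_max => /andP[Nn _].
have /= := hN n Nn; rewrite (_ : 1 = (1 : R)%:C%C) // sqnorm_lt // => h.
have : sqnorm (u n) <= M.
  move: h; rewrite /M {hN Nn M}; case: (u n) L => s t [s' t']; rewrite /sqnorm /=.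
  have := sqr_ge0 (2 * s' - s); have := sqr_ge0 (2 * t' - t); lra.
move=> /le_trans; apply; apply: (@le_trans _ _ (Num.bound M)%:R); last first.
  by rewrite ler_nat leq_maxr.
by apply/ltW/archi_boundP; rewrite /M addr_ge0 // mulr_ge0 // sqnorm_ge0.
Qed.

Lemma tails_vanish_cvgn m c x : tails_vanish m c x ->
  cvgn (fun n => trig_sum (iota 1 n) m c x : (R[i])^o).
Proof.
move=> h.
have tail N j : trig_sum (iota 1 (N + j)) m c x =
    trig_sum (iota 1 N) m c x + trig_sum (iota N.+1 j) m c x.
  by rewrite iotaD trig_sum_cat add1n.
have key e : 0 < e -> exists N, forall j,
    sqnorm (trig_sum (iota N.+1 j) m c x) <= e ^+ 2.
  (* The fourth power of [e] matches the fourth power of the modulus in [tails_vanish]. *)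
  move=> e0; have [N hN] := h (e ^+ 4) (exprn_gt0 _ e0); exists N => j.
  rewrite -ler_sqr ?nnegrE ?sqnorm_ge0 ?exprn_ge0 ?(ltW e0) //.
  by rewrite -exprM; exact: hN.
apply: complex_cvgn; apply: cauchy_tail_cvgn => e e0;
  have [N hN] := key e e0; exists N => j; have := hN j;
  rewrite tail ?ReD ?ImD addrAC subrr add0r => H;
  rewrite -ler_sqr ?nnegrE ?(ltW e0) // real_normK ?num_real //;
  apply: le_trans H; rewrite /sqnorm ?lerDl ?lerDr sqr_ge0 //.
Qed.

(** Using [N] both as starting index and as bound makes these sets decrease with [N]; no point where
    the partial sums converge lies in all of them. *)
Definition exceeds m c a (N : nat) : set R :=
  period a `&` [set x | exists2 n, (N <= n)%N &
                         N%:R < sqnorm (trig_sum (iota 1 n) m c x)].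

Lemma measurable_exceeds m c a N : measurable (exceeds m c a N).
Proof.
rewrite (_ : exceeds m c a N = \bigcup_(n in [set n | (N <= n)%N])
   (period a `&` [set x | N%:R < sqnorm (trig_sum (iota 1 n) m c x)])).
  apply: bigcup_measurable => n _; apply: measurable_superlevel.
    exact: measurable_period.
  exact: measurable_sqnorm_trig_sum.
apply/seteqP; split=> x; last by move=> [n /= Nn [px h]]; split => //; exists n.
by move=> [px [n Nn h]]; exists n.
Qed.

(* Integrate |S_n|^2 <= N off [exceeds] and 2 |S_n|^2 <= lam + |S_n|^4 / lam on it. *)
Lemma square_sum_le m c B a N n : {in iota 1 n &, injective m} ->
  additive_multiplicity_le B m (iota 1 n) -> (N <= n)%N ->
  (mu (exceeds m c a N) <= ((pi *+ 2 * B%:R + 1)^-1)%:E)%E ->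
  \sum_(k <- iota 1 n) sqnorm (c k) <= 2 * N%:R.
Proof.
move=> mI hB Nn; set A := exceeds m c a N; set K := pi *+ 2 * B%:R => muA.
have K0 : 0 <= K by rewrite mulr_ge0 // ltW // pi2_gt0.
set s := \sum_(k <- _) _.
have [s0|s0] : s = 0 \/ 0 < s.
  have : 0 <= s by apply: sumr_ge0 => *; exact: sqnorm_ge0.
  by rewrite le_eqVlt => /orP[/eqP ->|]; [left|right].
  by rewrite s0 mulr_ge0.
(* The integral of |S_n|^4 is at most K s^2 and the measure of [A] at most 1 / (K + 1), so with this
   [lam] both correction terms are at most [s / 2]. *)
pose lam := (K + 1) * s; have lam0 : 0 < lam by rewrite mulr_gt0 // ltr_wpDl.
pose S x := sqnorm (trig_sum (iota 1 n) m c x).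
have S0 x : 0 <= S x by exact: sqnorm_ge0.
have mS : measurable_fun (period a) S by exact: measurable_sqnorm_trig_sum.
have mA : measurable A by exact: measurable_exceeds.
have mP := measurable_period a.
have pw x : period a x ->
    S x <= N%:R + (lam / 2 * \1_A x + (2 * lam)^-1 * S x ^+ 2).
  move=> px; have [xA|xA] := pselect (A x).
    rewrite indicE mem_set // mulr1.
    have : 0 <= (2 * lam)^-1 * (S x - lam) ^+ 2.
      by rewrite mulr_ge0 ?sqr_ge0 // invr_ge0 mulr_ge0 // ltW.
    have -> : (2 * lam)^-1 * (S x - lam) ^+ 2 =
       (2 * lam)^-1 * S x ^+ 2 - S x + lam / 2 by field; rewrite gt_eqF.
    have : 0 <= N%:R :> R by [].
    lra.
  rewrite indicE memNset // mulr0 add0r.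
  have : S x <= N%:R by rewrite leNgt; apply/negP => h; apply: xA; split => //; exists n.
  have : 0 <= (2 * lam)^-1 * S x ^+ 2.
    by rewrite mulr_ge0 ?sqr_ge0 // invr_ge0 mulr_ge0 // ltW.
  lra.
have Eint := parseval_inj _ _ _ c a (iota_uniq 1 n) mI.
have mE (f : R -> R) : measurable_fun (period a) f -> measurable_fun (period a) (EFin \o f).
  by move=> mf; apply/measurable_EFinP.
have mI1 : measurable_fun (period a) (\1_A : R -> R).
  by apply: measurable_funTS; exact: measurable_indic.
have mS2 : measurable_fun (period a) (fun x => S x ^+ 2) by exact: measurable_funX.
have : (\int[mu]_(x in period a) (S x)%:E <=
  \int[mu]_(x in period a) (N%:R%:E +
    ((lam / 2)%:E * (\1_A x)%:E + ((2 * lam)^-1)%:E * (S x ^+ 2)%:E)))%E.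
  apply: ge0_le_integral => //.
  - by move=> x _; rewrite lee_fin.
  - exact: mE.
  - apply: emeasurable_funD => //; apply: emeasurable_funD; apply: measurable_funeM; exact: mE.
rewrite Eint.
have l1 : (0 <= (lam / 2)%:E)%E by rewrite lee_fin divr_ge0 // ltW.
have l2 : (0 <= ((2 * lam)^-1)%:E)%E by rewrite lee_fin invr_ge0 mulr_ge0 // ltW.
have i1 x : (0 <= (\1_A x : R)%:E)%E by rewrite lee_fin indicE.
have i2 x : (0 <= (S x ^+ 2)%:E)%E by rewrite lee_fin sqr_ge0.
rewrite ge0_integralD //; last 2 first.
- by move=> x _; rewrite adde_ge0 // mule_ge0.
- apply: emeasurable_funD; apply: measurable_funeM; exact: mE.
rewrite ge0_integralD //; last 4 first.
- by move=> x _; rewrite mule_ge0.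
- by apply: measurable_funeM; exact: mE.
- by move=> x _; rewrite mule_ge0.
- by apply: measurable_funeM; exact: mE.
rewrite !ge0_integralZl //; last 2 first.
- exact: mE.
- exact: mE.
rewrite integral_cst // measure_period integral_indic // => h.
have : ((pi *+ 2 * s)%:E <= (N%:R * (pi *+ 2) +
    (lam / 2 * (K + 1)^-1 + (2 * lam)^-1 * (K * s ^+ 2)))%:E)%E.
  apply: le_trans h _; rewrite (EFinD (N%:R * (pi *+ 2))).
  rewrite (EFinD (lam / 2 * (K + 1)^-1)); apply: leeD; first by rewrite EFinM.
  apply: leeD; rewrite [leRHS]EFinM.
    apply: lee_wpmul2l => //; apply: le_trans muA.
    by apply: le_measure; rewrite ?inE //; exact: measurableI.
  apply: lee_wpmul2l => //; have := integral_L4_le B m c _ a hB.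
  by rewrite -/K -/s mulrA.
rewrite lee_fin; clear h l1 l2 i1 i2 Eint muA.
have -> : lam / 2 * (K + 1)^-1 = s / 2 by rewrite /lam; field; lra.
have h2 : (2 * lam)^-1 * (K * s ^+ 2) <= s / 2.
  rewrite mulrC ler_pdivrMr ?mulr_gt0 // /lam; nra.
(* What remains is 2 pi s <= 2 pi N + s, and the last [s] is absorbed because pi is large enough. *)
have P2 : 2 <= pi :> R by exact: pi_ge2.
move=> H; rewrite -(ler_pM2l (pi_gt0 R)).
have : 0 <= (pi - 2) * s by rewrite mulr_ge0 ?subr_ge0 // ltW.
by move: H h2; rewrite mulr2n; move: ((2 * lam)^-1 * _) (pi : R) => X P; lra.
Qed.

(** Continuity from above: the sets decrease inside a period of finite measure, and their
    intersection is null because a convergent sequence is bounded. *)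
Lemma exceeds_small m c a (e : R) : 0 < e ->
  {ae mu, forall x, cvgn (fun n => trig_sum (iota 1 n) m c x : (R[i])^o)} ->
  exists N, (mu (exceeds m c a N) <= e%:E)%E.
Proof.
move=> e0 ae.
have ni : nonincreasing_seq (exceeds m c a).
  move=> I J IJ; apply/subsetPset => x [px [n Jn h]]; split => //.
  exists n; first exact: leq_trans Jn.
  by apply: le_lt_trans h; rewrite ler_nat.
have mE := measurable_exceeds m c a.
have mB : measurable (\bigcap_N exceeds m c a N) by exact: bigcapT_measurable.
have fin : (mu (exceeds m c a 0) < +oo)%E.
  apply: (@le_lt_trans _ _ (mu (period a))); last by rewrite measure_period ltry.
  apply: le_measure; rewrite ?inE //; [exact: mE|exact: measurable_period|by move=> x []].
have B0 : mu (\bigcap_N exceeds m c a N) = 0%E.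
  apply/negligibleP => //; apply: negligibleS ae => x hx cv.
  have [N hN] := cvgn_eventually_bounded _ cv.
  have [_ [n Nn]] := hx N I.
  by rewrite ltNge hN.
have mu_cvg := @nonincreasing_cvg_mu _ _ _ mu _ fin mE mB ni.
apply: contrapT => h.
have : (e%:E <= limn (mu \o exceeds m c a))%E.
  apply: lime_ge; first exact: cvgP mu_cvg.
  by apply: nearW => N /=; rewrite leNgt; apply/negP => /ltW hN; apply: h; exists N.
by rewrite (cvg_lim _ mu_cvg) // B0 lee_fin leNgt e0.
Qed.

End Convergence.

Theorem corollary1p3 (R : realType) (l : nat) (hl : (1 <= l)%N)
    (m : nat -> nat) (hm : enumeration (dyadic_sums_le l) m) (c : nat -> R[i]) :
  {ae lebesgue_measure, forall x : R,
    cvgn (fun n : nat => \sum_(1 <= k < n.+1) c k * expi ((m k)%:R * x) : (R[i])^o)}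
  <-> (\sum_(1 <= k <oo) ((Normc.normc (c k)) ^+ 2)%:E < +oo)%E.
Proof.
have [mD mI _] := hm.
have m1 n : {subset iota 1 n <= [pred k | (1 <= k)%N]}.
  by move=> k; rewrite mem_iota inE => /andP[].
have mInj n : {in iota 1 n &, injective m}.
  by move=> i j /m1 hi /m1 hj; apply: mI; rewrite inE.
have hB n : additive_multiplicity_le (pow2_subsums_bound (l + l)) m (iota 1 n).
  move=> N; apply: dyadic_add_count => //; first exact: iota_uniq.
  by move=> k /m1 k1; apply: mD.
have gE (n : nat) : (\sum_(1 <= k < n.+1) ((Normc.normc (c k)) ^+ 2)%:E =
    (\sum_(k <- iota 1 n) sqnorm (c k))%:E)%E.
  rewrite /index_iota subn1 -sumEFin; apply: eq_bigr => k _.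
  by rewrite sqnormE.
have SE x (n : nat) : \sum_(1 <= k < n.+1) c k * expi ((m k)%:R * x) =
    trig_sum (iota 1 n) m c x by rewrite /trig_sum /index_iota subn1.
have g0 (n : nat) : (1 <= n)%N -> true -> (0 <= ((Normc.normc (c n)) ^+ 2)%:E)%E.
  by move=> _ _; rewrite lee_fin sqr_ge0.
split=> [cv|fin].
  set K : R := pi *+ 2 * (pow2_subsums_bound (l + l))%:R.
  have K1 : 0 < (K + 1)^-1 by rewrite invr_gt0 ltr_wpDl // mulr_ge0 // ltW // pi2_gt0.
  have [|N hN] := @exceeds_small R m c 0 _ K1.
    apply: negligibleS cv => x /= nc nv; apply: nc.
    by move: nv; under eq_fun do rewrite SE.
  apply: (@le_lt_trans _ _ (2 * N%:R)%:E); last exact: ltry.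
  apply: lime_le; first exact: is_cvg_nneseries_cond g0.
  (* The sum up to index [n] is the term of rank [n.+1] in the sequence defining the series, hence
     the shift from [N] to [N.+1]. *)
  exists N.+1 => // -[//|n] /= Nn; rewrite gE lee_fin.
  exact: square_sum_le (mInj n) (hB n) Nn hN.
pose M := fine (\sum_(1 <= k <oo) ((Normc.normc (c k)) ^+ 2)%:E).
have hM n : \sum_(k <- iota 1 n) sqnorm (c k) <= M.
  rewrite -lee_fin -gE fineK; first exact: nneseries_lim_ge g0.
  by rewrite ge0_fin_numE //; apply: nneseries_ge0 => k k1 _; apply: g0.
have := negligible_non_vanishing m c _ M hB hM; apply: negligibleS => x /= nc nv.
apply: nc; under eq_fun do rewrite SE; exact: tails_vanish_cvgn.
Qed.
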